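(* Let $f(t)=\sum_{n\ge1}f_n t^n/n!$ be a real formal power series with $f_1\neq0$, and let $R=\mathcal{R}[f',f]=[R_{n,k}]_{n,k\ge0}$ be the associated exponential Riordan array. If $f'$ is a PF formal power series, then $R$ and its reversal $\overleftarrow{R}=[R_{n,n-k}]_{n,k\ge0}$ are both totally positive, and for each $n\ge0$ the row generating polynomial $\sum_{k=0}^n R_{n,k}x^k$ is real-rooted.
   Context: For formal power series $g(t)=\sum_{n\ge0}g_nt^n/n!$ with $g_0\ne0$ and $f(t)=\sum_{n\ge1}f_nt^n/n!$ with $f_1\ne0$, the exponential Riordan array $\mathcal{R}[g,f]$ is the lower triangular matrix $[R_{n,k}]_{n,k\ge0}$ with $R_{n,k}=\frac{n!}{k!}[t^n]\,g(t)f(t)^k$. A matrix is totally positive if all its minors are nonnegative. A sequence $(c_n)_{n\ge0}$ of nonnegative reals is a Pólya frequency (PF) sequence if its Toeplitz matrix $[c_{i-j}]_{i,j\ge0}$ (with $c_k=0$ for $k<0$) is totally positive; a formal power series $\sum_n c_nt^n$ is PF if its coefficient sequence $(c_n)$ is PF. In the reversal, $R_{n,n-k}=0$ for $k>n$. A polynomial is real-rooted if it is constant or all its zeros are real. *)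

(* Defs.v *)
From HB Require Import structures.
From mathcomp Require Import all_boot all_order all_algebra.
From mathcomp Require Import reals.
From mathcomp Require Import complex.

Set Implicit Arguments.
Unset Strict Implicit.
Unset Printing Implicit Defensive.

Import Order.TTheory GRing.Theory Num.Theory.
Local Open Scope ring_scope.

(* A formal power series is its sequence of ordinary coefficients:
   a : nat -> R stands for \sum_n a_n t^n. *)

Definition fps_one (R : nzRingType) : nat -> R := fun n => (n == 0%N)%:R.

Definition fps_mul (R : nzRingType) (a b : nat -> R) : nat -> R :=
  fun n => \sum_(i < n.+1) a i * b (n - i)%N.

Definition fps_exp (R : nzRingType) (a : nat -> R) (k : nat) : nat -> R :=
  iter k (fps_mul a) (fps_one R).

Definition fps_deriv (R : nzRingType) (a : nat -> R) : nat -> R :=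
  fun n => a n.+1 *+ n.+1.

(* \sum_n u_n t^n / n! *)
Definition egf (R : fieldType) (u : nat -> R) : nat -> R :=
  fun n => u n / n`!%:R.

Definition exp_riordan (R : fieldType) (g f : nat -> R) : nat -> nat -> R :=
  fun n k => n`!%:R / k`!%:R * fps_mul g (fps_exp f k) n.

Definition reversal (R : nzRingType) (M : nat -> nat -> R) : nat -> nat -> R :=
  fun n k => if (k <= n)%N then M n (n - k)%N else 0.

Definition totally_positive (R : numDomainType) (M : nat -> nat -> R) : Prop :=
  forall (m : nat) (r c : 'I_m -> nat),
    {homo r : i j / (i < j)%N} -> {homo c : i j / (i < j)%N} ->
    0 <= \det (\matrix_(i < m, j < m) M (r i) (c j)).

Definition toeplitz (R : nzRingType) (c : nat -> R) : nat -> nat -> R :=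
  fun i j => if (j <= i)%N then c (i - j)%N else 0.

Definition pf_seq (R : numDomainType) (c : nat -> R) : Prop :=
  (forall n, 0 <= c n) /\ totally_positive (toeplitz c).

Definition row_poly (R : nzRingType) (M : nat -> nat -> R) (n : nat) : {poly R} :=
  \poly_(k < n.+1) M n k.

(* The zeros range over the complex numbers R[i]. *)
Definition real_rooted (R : rcfType) (p : {poly R}) : Prop :=
  (size p <= 1)%N \/
  forall z : complex R, root (map_poly (real_complex R) p) z -> complex.Im z = 0.

(* Main.v *)
(* Let [c] be the coefficient sequence of f', [T n j = n!/j! * c_(n-j)] and [M] the
   Riordan array.  Since n [t^n] f^k = k [t^(n-1)] f' f^(k-1), one has
   [M = T * (1 (+) M)], where [T] is totally positive and lower triangular.
   By Whitney's reduction every finite section of [T] is a product of nonnegative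
   operations "add a multiple of row i to row i + 1" and a positive diagonal matrix.
   Such operations preserve total positivity, so the total positivity of [M] follows
   by induction on the number of columns.  Applying them one at a time to the
   reversed row polynomials, and listing all intermediate polynomials in a single
   sequence, gives b_(s+1) = d_s b_s + w_s x b_(s-q) with d_s > 0, w_s >= 0 and q
   constant.  Hence the coefficient array of (b_s) is again totally positive, by
   induction on columns.  Moreover, for fixed non-real x, the recurrence keeps the
   arguments of b_(s-q), ..., b_s ordered inside a cone of opening |arg x| < pi, so
   that b_s(x) never vanishes. *)
Require Import Defs.
From mathcomp Require Import all_boot all_order all_algebra.
From mathcomp Require Import perm.
From mathcomp Require Import reals.
From mathcomp Require Import complex.
From mathcomp Require Import zify ring lra.

Set Implicit Arguments.
Unset Strict Implicit.
Unset Printing Implicit Defensive.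

Import Order.TTheory GRing.Theory Num.Theory.
Local Open Scope ring_scope.

(** * Minors and Whitney's reduction *)

Definition minor (R : comNzRingType) (A : nat -> nat -> R) (m : nat)
  (r c : 'I_m -> nat) : R := \det (\matrix_(i < m, j < m) A (r i) (c j)).

(** The bound [K] supports induction on the number of columns, and the bound [N] confines
    elimination to a finite section. *)
Definition tp_on (R : numDomainType) (N K : nat) (A : nat -> nat -> R) : Prop :=
  forall (m : nat) (r c : 'I_m -> nat),
    {homo r : i j / (i < j)%N} -> {homo c : i j / (i < j)%N} ->
    (forall i, (r i < N)%N) -> (forall j, (c j < K)%N) -> 0 <= minor A r c.

(** The result need not be increasing, which is why [minor] accepts arbitrary index functions:
    repeated rows give zero and exchanged rows give a sign. *)
Definition upd (m : nat) (r : 'I_m -> nat) (t : 'I_m) (p : nat) : 'I_m -> nat :=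
  fun l => if l == t then p else r l.

Lemma eq_minor (R : comNzRingType) (A A' : nat -> nat -> R) m
    (r r' c c' : 'I_m -> nat) :
    (forall i j, A (r i) (c j) = A' (r' i) (c' j)) ->
  minor A r c = minor A' r' c'.
Proof. by move=> e; congr (\det _); apply/matrixP => i j; rewrite !mxE. Qed.

Lemma minor_upd (R : comNzRingType) (A : nat -> nat -> R) m
    (r c : 'I_m -> nat) t p :
  r t = p -> minor A (upd r t p) c = minor A r c.
Proof.
move=> e; apply: eq_minor => i j; rewrite /upd.
by case: eqP => // ->; rewrite e.
Qed.

Lemma minor_eq_rows (R : comNzRingType) (A : nat -> nat -> R) m
    (r c : 'I_m -> nat) (i i' : 'I_m) :
  i != i' -> r i = r i' -> minor A r c = 0.
Proof.
move=> ne e; apply: (determinant_alternate ne) => j.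
by rewrite !mxE e.
Qed.

Lemma minor_col0 (R : comNzRingType) (A : nat -> nat -> R) m
    (r c : 'I_m -> nat) (j : 'I_m) :
  (forall i, A (r i) (c j) = 0) -> minor A r c = 0.
Proof.
move=> e; rewrite /minor (expand_det_col _ j) big1 // => i _.
by rewrite mxE e mul0r.
Qed.

Lemma minor_row0 (R : comNzRingType) (A : nat -> nat -> R) m
    (r c : 'I_m -> nat) (i : 'I_m) :
  (forall j, A (r i) (c j) = 0) -> minor A r c = 0.
Proof.
move=> e; rewrite /minor (expand_det_row _ i) big1 // => j _.
by rewrite mxE e mul0r.
Qed.

Lemma minor_upd_swap (R : comNzRingType) (A : nat -> nat -> R) m
    (r c : 'I_m -> nat) (a b : 'I_m) p q : a != b ->
  minor A (upd (upd r a p) b q) c = - minor A (upd (upd r a q) b p) c.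
Proof.
move=> ne; rewrite /minor.
set X := (X in \det X = _); set Y := (Y in _ = - \det Y).
have -> : X = xrow a b Y.
  apply/matrixP => i j; rewrite !mxE /upd.
  case: tpermP => [->|->|/eqP/negPf -> /eqP/negPf ->] //.
  - by rewrite eqxx (negPf ne) eqxx.
  - by rewrite !eqxx (negPf ne).
by rewrite xrowE det_mulmx det_perm odd_tperm ne expr1 mulN1r.
Qed.

Lemma cofactor_minor (R : comNzRingType) (A : nat -> nat -> R) m
    (r c : 'I_m.+1 -> nat) i j :
  cofactor (\matrix_(i < m.+1, j < m.+1) A (r i) (c j)) i j =
  (-1) ^+ (i + j) * minor A (r \o lift i) (c \o lift j).
Proof.
rewrite /cofactor; congr (_ * \det _).
by apply/matrixP => k l; rewrite !mxE.
Qed.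

Lemma minor_row (R : comNzRingType) (A : nat -> nat -> R) m
    (r c : 'I_m.+1 -> nat) i :
  minor A r c = \sum_j A (r i) (c j) *
    ((-1) ^+ (i + j) * minor A (r \o lift i) (c \o lift j)).
Proof.
rewrite /minor (expand_det_row _ i); apply: eq_bigr => j _.
by rewrite cofactor_minor mxE.
Qed.

Lemma minor_col (R : comNzRingType) (A : nat -> nat -> R) m
    (r c : 'I_m.+1 -> nat) j :
  minor A r c = \sum_i A (r i) (c j) *
    ((-1) ^+ (i + j) * minor A (r \o lift i) (c \o lift j)).
Proof.
rewrite /minor (expand_det_col _ j); apply: eq_bigr => i _.
by rewrite cofactor_minor mxE.
Qed.

Lemma minor_upd_row (R : comNzRingType) (A : nat -> nat -> R) m
    (r c : 'I_m.+1 -> nat) i p :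
  minor A (upd r i p) c = \sum_j A p (c j) *
    ((-1) ^+ (i + j) * minor A (r \o lift i) (c \o lift j)).
Proof.
rewrite (minor_row _ _ _ i); apply: eq_bigr => j _.
rewrite {1}/upd eqxx; congr (_ * (_ * _)); apply: eq_minor => k l /=.
by rewrite /upd eq_sym (negPf (neq_lift _ _)).
Qed.

(* Cramer's rule expresses the unit vector e_j in the rows of [r]; applying to
   it the linear form "put in row b of [upd r a q]" leaves only two terms. *)
Lemma minor_plucker (R : comNzRingType) (A : nat -> nat -> R) m
    (r c : 'I_m.+1 -> nat) (a b j : 'I_m.+1) q : a != b ->
  minor A r c * ((-1) ^+ (b + j) *
    minor A (upd r a q \o lift b) (c \o lift j)) =
  (-1) ^+ (a + j) * minor A (r \o lift a) (c \o lift j) *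
    minor A (upd (upd r a q) b (r a)) c +
  (-1) ^+ (b + j) * minor A (r \o lift b) (c \o lift j) *
    minor A (upd r a q) c.
Proof.
move=> ne; set N := \matrix_(i < m.+1, k < m.+1) A (r i) (c k).
pose cf (k : 'I_m.+1) := (-1) ^+ (b + k) * minor A (upd r a q \o lift b) (c \o lift k).
have cramer (k : 'I_m.+1) : \sum_t cofactor N t j * A (r t) (c k) =
    if j == k then minor A r c else 0.
  have /matrixP/(_ j k) := mul_adj_mx N; rewrite !mxE -mulrb => <-.
  by apply: eq_bigr => t _; rewrite !mxE.
transitivity (\sum_k (if j == k then minor A r c else 0) * cf k).
  rewrite (bigD1 j) //= eqxx big1 ?addr0 // => k kj.
  by rewrite eq_sym (negPf kj) mul0r.
transitivity (\sum_t cofactor N t j * minor A (upd (upd r a q) b (r t)) c).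
  under eq_bigr do rewrite -cramer mulr_suml.
  rewrite exchange_big; apply: eq_bigr => t _ /=.
  by rewrite minor_upd_row mulr_sumr; apply: eq_bigr => k _; rewrite -mulrA.
have ba : b != a by rewrite eq_sym.
rewrite (bigD1 a) //= (bigD1 b) //= [X in _ + (_ + X)]big1 => [|t /andP[ta tb]].
  rewrite addr0 !cofactor_minor; congr (_ + _ * _).
  by rewrite minor_upd // /upd (negPf ba).
rewrite (@minor_eq_rows _ _ _ _ _ t b) ?mulr0 //.
by rewrite /upd eqxx (negPf ta) (negPf tb).
Qed.

Lemma lift_homo m (r : 'I_m.+1 -> nat) a :
  {homo r : i j / (i < j)%N} -> {homo (r \o lift a) : i j / (i < j)%N}.
Proof.
by move=> hr i j ij; apply: hr; rewrite ltnNge leq_bump2 -ltnNge.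
Qed.

Lemma upd_pred_homo m (r : 'I_m -> nat) t p :
    {homo r : i j / (i < j)%N} -> r t = p.+1 -> (forall i, r i <> p) ->
  {homo (upd r t p) : i j / (i < j)%N}.
Proof.
move=> hr rt rp i j ij; have := hr _ _ ij; rewrite /upd.
case: eqP => [it|_]; case: eqP => [jt|_] //.
- by rewrite it jt !ltnn.
- by rewrite it rt; lia.
- by rewrite jt rt; have := rp i; lia.
Qed.

(* When [t] is not the first position, Plucker's relation reduces the claim to the
   submatrix without the preceding row and a column [j] whose cofactor is nonzero. *)
Lemma whitney_ratio (R : realFieldType) (A : nat -> nat -> R) N K p j0 :
    tp_on N K A -> (p.+1 < N)%N -> (j0 < K)%N ->
    (forall n k, (p <= n < N)%N -> (k < j0)%N -> A n k = 0) ->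
    (forall n, (p.+1 < n < N)%N -> A n j0 = 0) ->
    0 < A p j0 ->
  forall m (r c : 'I_m -> nat) (t : 'I_m),
    {homo r : i j / (i < j)%N} -> {homo c : i j / (i < j)%N} ->
    (forall i, (r i < N)%N) -> (forall j, (c j < K)%N) ->
    r t = p.+1 -> (forall i, r i <> p) ->
  A p.+1 j0 * minor A (upd r t p) c <= A p j0 * minor A r c.
Proof.
move=> tpA pN jK zlt zcol alpha_gt0; elim=> [|m IH] r c t hr hc rN cK rt rp.
  by case: t rt.
have hupd := upd_pred_homo hr rt rp.
have updN : forall i, (upd r t p i < N)%N.
  by move=> i; rewrite /upd; case: eqP => // _; lia.
case: (posnP t) => [t0|t_gt0].
  (* All rows other than [t] lie below [p.+1], so they vanish in every column up to [j0]. *)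
  have te : t = ord0 by apply: val_inj.
  have rgt i : i != t -> (p.+1 < r i)%N.
    by rewrite te -rt te => i0; apply: hr; rewrite lt0n.
  have zr i k : i != t -> (k <= j0)%N -> A (r i) k = 0.
    move=> it; rewrite leq_eqVlt => /orP[/eqP ->|kj].
      by apply: zcol; rewrite rgt ?rN.
    by apply: zlt => //; have := rgt _ it; have := rN i; lia.
  rewrite -subr_ge0.
  case: (leqP (c ord0) j0) => [cj|cj].
    rewrite (minor_col _ r c ord0) (minor_col _ (upd r t p) c ord0).
    rewrite (bigD1 t) //= [X in _ * (_ + X)]big1 ?addr0; last first.
      by move=> i it; rewrite zr // mul0r.
    rewrite (bigD1 t) //= [X in _ - _ * (_ + X)]big1 ?addr0; last first.
      by move=> i it; rewrite /upd (negPf it) zr // mul0r.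
    rewrite rt {1}/upd eqxx.
    have -> : minor A (upd r t p \o lift t) (c \o lift ord0) =
              minor A (r \o lift t) (c \o lift ord0).
      apply: eq_minor => k l /=.
      by rewrite /upd eq_sym (negPf (neq_lift _ _)).
    move: cj; rewrite leq_eqVlt => /orP[/eqP ->|cj].
      by rewrite mulrCA subrr.
    by rewrite (zlt p.+1 (c ord0)) 1?(zlt p (c ord0)) ?mul0r ?mulr0 ?subrr //; lia.
  (* Border the minor by row [p] and column [j0]. Only two entries of column [j0] survive, and
     expanding along it gives exactly the difference to be bounded. *)
  pose r' (i : 'I_m.+2) := oapp r p (unlift ord0 i).
  pose c' (i : 'I_m.+2) := oapp c j0 (unlift ord0 i).
  have big_ge0 : 0 <= minor A r' c'.
    apply: tpA.
    - move=> i j; rewrite /r'; case: unliftP => [i'|] ->; case: unliftP => [j'|] -> //=.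
        by rewrite /bump /= !add1n ltnS; apply: hr.
      move=> _; case: (eqVneq j' t) => [->|/rgt]; first by rewrite rt.
      by lia.
    - move=> i j; rewrite /c'; case: unliftP => [i'|] ->; case: unliftP => [j'|] -> //=.
        by rewrite /bump /= !add1n ltnS; apply: hc.
      move=> _; apply: leq_trans cj _.
      case: (posnP j') => [j'0|]; first by rewrite (_ : j' = ord0) //; apply: val_inj.
      by move=> j'0; apply/ltnW/hc.
    - by move=> i; rewrite /r'; case: unliftP => [i'|] _ //=; lia.
    - by move=> i; rewrite /c'; case: unliftP => [i'|] _ //=; lia.
  apply: le_trans big_ge0 _; rewrite le_eqVlt; apply/orP; left; apply/eqP.
  have r'S k : r' (lift ord0 k) = r k by rewrite /r' liftK.
  have c'S k : c' (lift ord0 k) = c k by rewrite /c' liftK.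
  have r'0 : r' ord0 = p by rewrite /r' unlift_none.
  have c'0 : c' ord0 = j0 by rewrite /c' unlift_none.
  rewrite (minor_col _ _ _ ord0) big_ord_recl (bigD1 t) //=.
  rewrite [X in _ + (_ + X)]big1; last first.
    by move=> i it; rewrite r'S c'0 zr // mul0r.
  rewrite r'0 r'S c'0 rt addr0 te /= /bump /= addn0 expr0 expr1 mul1r mulN1r mulrN.
  congr (_ * _ - _ * _).
    by apply: eq_minor => k l /=; rewrite r'S c'S.
  apply: eq_minor => k l /=; rewrite c'S /upd; congr (A _ _).
  case: eqP => [->|/eqP k0].
    by rewrite (_ : lift _ _ = ord0) ?r'0 //; apply: val_inj.
  rewrite -r'S; congr r'; apply: val_inj => /=; rewrite /bump /=.
  by move: k0; rewrite -val_eqE /= -lt0n => ->.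
have [->|Xp_neq0] := eqVneq (minor A (upd r t p) c) 0.
  by rewrite mulr0 mulr_ge0 ?(ltW alpha_gt0) //; apply: tpA.
have a_lt : (t.-1 < m.+1)%N by have := ltn_ord t; lia.
pose a := Ordinal a_lt.
have ab : a != t by apply/eqP => /(congr1 val) /=; lia.
have a_ltm : (a < m)%N by rewrite /=; have := ltn_ord t; lia.
pose s := Ordinal a_ltm.
have st : lift a s = t by apply: val_inj; rewrite /= /bump leqnn; lia.
have rat : (r a < p)%N.
  have : (r a < r t)%N by apply: hr; rewrite /=; lia.
  by have := rp a; rewrite rt; lia.
have [j cfj] : exists j, minor A (upd r t p \o lift a) (c \o lift j) != 0.
  apply/existsP; apply: contraNT Xp_neq0; rewrite negb_exists => /forallP z.
  rewrite (minor_row _ _ _ a) big1 // => j _.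
  by move: (z j); rewrite negbK => /eqP ->; rewrite !mulr0.
have Yp_gt0 : 0 < minor A (upd r t p \o lift a) (c \o lift j).
  by rewrite lt_def cfj; apply: tpA => [|| i | i] //=; apply: lift_homo.
have IHa : A p.+1 j0 * minor A (upd r t p \o lift a) (c \o lift j) <=
           A p j0 * minor A (r \o lift a) (c \o lift j).
  have -> : minor A (upd r t p \o lift a) (c \o lift j) =
            minor A (upd (r \o lift a) s p) (c \o lift j).
    apply: eq_minor => k l /=.
    by rewrite /upd -st (inj_eq (lift_inj)).
  by apply: IH => //=; rewrite ?st ?rt //; apply: lift_homo.
(* Positions [a] and [t] are adjacent, so putting [p.+1] at [a] and deleting [t] leaves the rows of
   [r] without [r a]. The other two updated minors are increasing up to one exchange, hence the
   signs in [e2] and [e3]. *)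
have key := minor_plucker A (upd r t p) c j p.+1 ab.
have e1 : minor A (upd (upd r t p) a p.+1 \o lift t) (c \o lift j) =
          minor A (r \o lift a) (c \o lift j).
  apply: eq_minor => k l /=; congr (A _ _).
  rewrite /upd [lift t k == t]eq_sym (negPf (neq_lift _ _)).
  case: eqP => [/(congr1 val) /= kt|/eqP kt].
    rewrite -rt; congr r; apply: val_inj => /=.
    by move: kt; rewrite /bump; case: (leqP t k); case: (leqP t.-1 k) => /=; lia.
  congr r; apply: val_inj => /=; move: kt; rewrite -val_eqE /= /bump.
  by case: (leqP t k); case: (leqP t.-1 k) => /=; lia.
have e2 : minor A (upd (upd (upd r t p) a p.+1) t (upd r t p a)) c = - minor A r c.
  rewrite minor_upd_swap //; congr (- _); apply: eq_minor => k l; congr (A _ _).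
  by rewrite /upd (negPf ab); case: eqP => [->|_] //; case: eqP => [->|].
have e3 : minor A (upd (upd r t p) a p.+1) c = - minor A (upd r a p) c.
  have <- : minor A (upd (upd r a p) t p.+1) c = minor A (upd r a p) c.
    by rewrite minor_upd // /upd eq_sym (negPf ab).
  rewrite [in RHS]minor_upd_swap // opprK; apply: eq_minor => k l; congr (A _ _).
  by rewrite /upd; case: (eqVneq k a) => [->|_] //; rewrite (negPf ab).
have Z1 : 0 <= minor A (upd r t p \o lift t) (c \o lift j).
  by apply: tpA => [|| i | i] //=; apply: lift_homo.
have Z2 : 0 <= minor A (upd r a p) c.
  apply: tpA => // [k l kl|k]; rewrite /upd; last by case: eqP => // _; lia.
  have := hr _ _ kl; case: eqP => [ka|ka]; case: eqP => [la|la] //; rewrite ?ka ?la.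
  - by move: kl; rewrite ka la; lia.
  - move=> _; case: (eqVneq l t) => [->|lt]; first by rewrite rt.
    suff : (r t < r l)%N by rewrite rt; lia.
    by apply: hr; move: kl lt; rewrite ka -val_eqE /=; lia.
  - by lia.
move: key; rewrite e1 e2 e3.
have -> : (-1) ^+ (a + j) = - (-1) ^+ (t + j) :> R.
  by rewrite (_ : (t + j = (a + j).+1)%N) ?exprS ?mulN1r ?opprK //= ; lia.
set x := minor A (upd r t p) c; set y := minor A r c.
set u := minor A (upd r t p \o lift a) _ in IHa Yp_gt0 *.
set v := minor A (r \o lift a) _ in IHa *.
set w1 := minor A _ _ in Z1 *; set w2 := minor A _ _ in Z2 *.
set e := (-1) ^+ _ => key.
have {}key : x * v = u * y - w1 * w2.
  have e_neq0 : e != 0 by rewrite signr_eq0.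
  by apply: (mulfI e_neq0); move: key; lra.
have x_ge0 : 0 <= x by apply: tpA.
rewrite -(ler_pM2l Yp_gt0).
(* The claim has been multiplied by [u > 0]: the induction hypothesis bounds [A p.+1 j0 * u * x] by
   [A p j0 * (x * v)], and [key] bounds [x * v] by [u * y]. *)
have h1 : A p.+1 j0 * u * x <= A p j0 * v * x by apply: ler_wpM2r.
have h2 : A p j0 * (x * v) <= A p j0 * (u * y).
  by rewrite ler_wpM2l ?(ltW alpha_gt0) // key lerBlDr lerDl mulr_ge0.
by move: h1 h2; lra.
Qed.

(** * Elementary row operations and Whitney's factorization *)

Definition rowop (R : nzRingType) (e : nat * R) (v : nat -> R) : nat -> R :=
  fun n => v n + (if n == e.1.+1 then e.2 * v e.1 else 0).

Definition rowops (R : nzRingType) (es : seq (nat * R)) (v : nat -> R) : nat -> R :=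
  foldl (fun u e => rowop e u) v es.

Lemma minor_rowop (R : comNzRingType) (A : nat -> nat -> R) e m
    (r c : 'I_m -> nat) t :
    {homo r : i j / (i < j)%N} -> r t = e.1.+1 ->
  minor (fun n k => rowop e (A^~ k) n) r c =
  minor A r c + e.2 * minor A (upd r t e.1) c.
Proof.
case: m r c t => [|m] r c t hr rt; first by case: t rt.
rewrite (minor_row _ r c t) (minor_row _ _ _ t) minor_upd_row mulr_sumr.
rewrite -big_split /=; apply: eq_bigr => j _.
rewrite {1}/rowop rt eqxx mulrDl -mulrA; set x := minor _ _ _.
suff -> : x = minor A (r \o lift t) (c \o lift j) by [].
apply: eq_minor => k l; rewrite /rowop /=; case: eqP; rewrite ?addr0 // -rt.
have := neq_lift t k; case: (ltngtP t (lift t k)) => [/hr + _ eq | /hr + _ eq|].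
- by rewrite eq ltnn.
- by rewrite eq ltnn.
- by move=> /val_inj <-; rewrite eqxx.
Qed.

(** Whatever the sign of [e.2], a minor without row [e.1.+1] does not change, and if row [e.1] is
    also present the correction term has two equal rows. Only the minors in the hypothesis
    remain. *)
Lemma tp_rowop_neg (R : realFieldType) (A : nat -> nat -> R) N K e :
    (forall m (r c : 'I_m -> nat) t,
      {homo r : i j / (i < j)%N} -> {homo c : i j / (i < j)%N} ->
      (forall i, (r i < N)%N) -> (forall j, (c j < K)%N) ->
      r t = e.1.+1 -> (forall i, r i <> e.1) ->
      0 <= minor A r c + e.2 * minor A (upd r t e.1) c) ->
  tp_on N K A -> tp_on N K (fun n k => rowop e (A^~ k) n).
Proof.
move=> he tpA m r c hr hc rN cK.
have [/existsP[t /eqP rt]|] := boolP [exists t, r t == e.1.+1]; last first.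
  rewrite negb_exists => /forallP z.
  rewrite (_ : minor _ _ _ = minor A r c); first exact: tpA.
  by apply: eq_minor => i j; rewrite /rowop (negPf (z i)) addr0.
rewrite (minor_rowop A c hr rt).
have [/existsP[i /eqP ri]|] := boolP [exists i, r i == e.1]; last first.
  by rewrite negb_exists => /forallP z; apply: he => // i; apply/eqP.
have ti : t != i by apply/eqP => ti; move: rt; rewrite ti ri; lia.
rewrite (@minor_eq_rows _ _ _ (upd r t e.1) _ t i) // ?mulr0 ?addr0.
  exact: tpA.
by rewrite /upd eqxx eq_sym (negPf ti).
Qed.

(** Since row [e.1] is absent, lowering [e.1.+1] to [e.1] keeps the indices increasing, so both
    terms are nonnegative minors of [A]. *)
Lemma tp_rowop (R : realFieldType) (A : nat -> nat -> R) N K e :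
  0 <= e.2 -> tp_on N K A -> tp_on N K (fun n k => rowop e (A^~ k) n).
Proof.
move=> e_ge0 tpA; apply: tp_rowop_neg => // m r c t hr hc rN cK rt rp.
rewrite addr_ge0 ?mulr_ge0 //; apply: tpA => //.
  exact: upd_pred_homo.
by move=> i; rewrite /upd; case: eqP => // _; have := rN t; lia.
Qed.

Lemma eq_tp_on (R : realFieldType) (A A' : nat -> nat -> R) N K :
    (forall n k, (n < N)%N -> (k < K)%N -> A n k = A' n k) ->
  tp_on N K A -> tp_on N K A'.
Proof.
move=> e tpA m r c hr hc rN cK; rewrite -(@eq_minor _ A A' _ r r c c).
  exact: tpA.
by move=> i j; apply: e.
Qed.

Lemma tp_rowops (R : realFieldType) (A : nat -> nat -> R) N K es :
    all (fun e => 0 <= e.2) es ->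
  tp_on N K A -> tp_on N K (fun n k => rowops es (A^~ k) n).
Proof.
elim: es A => [|e es IH] A //= /andP[e_ge0 es_ge0] tpA.
by apply: (IH (fun n k => rowop e (A^~ k) n)) => //; apply: tp_rowop.
Qed.

Lemma tp_scale (R : realFieldType) (A : nat -> nat -> R) N K (x y : nat -> R) :
    (forall n, 0 <= x n) -> (forall n, 0 <= y n) ->
  tp_on N K A -> tp_on N K (fun n k => x n * A n k * y k).
Proof.
move=> x0 y0 tpA m r c hr hc rN cK.
have -> : minor (fun n k => x n * A n k * y k) r c =
    \det (diag_mx (\row_i x (r i)) *m (\matrix_(i, j) A (r i) (c j)) *m
          diag_mx (\row_i y (c i))).
  congr (\det _); apply/matrixP => i j.
  by rewrite mul_mx_diag mul_diag_mx !mxE.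
rewrite !det_mulmx !det_diag mulr_ge0 ?mulr_ge0 //.
- by apply: prodr_ge0 => i _; rewrite mxE.
- exact: tpA.
- by apply: prodr_ge0 => i _; rewrite mxE.
Qed.

Lemma minor1 (R : comNzRingType) (A : nat -> nat -> R) (r c : 'I_1 -> nat) :
  minor A r c = A (r 0) (c 0).
Proof. by rewrite /minor det_mx11 mxE. Qed.

Lemma minor2 (R : comNzRingType) (A : nat -> nat -> R) (r c : 'I_2 -> nat) :
  minor A r c = A (r 0) (c 0) * A (r 1) (c 1) - A (r 0) (c 1) * A (r 1) (c 0).
Proof.
rewrite (minor_row _ _ _ 0) big_ord_recl big_ord1 !minor1 /= expr0 expr1.
have -> : lift 0 0 = 1 :> 'I_2 by apply: val_inj.
have -> : lift 1 0 = 0 :> 'I_2 by apply: val_inj.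
by rewrite mul1r mulN1r mulrN.
Qed.

Lemma tp_entry (R : numDomainType) (A : nat -> nat -> R) N K n k :
  tp_on N K A -> (n < N)%N -> (k < K)%N -> 0 <= A n k.
Proof.
move=> tpA nN kK; rewrite -(minor1 A (fun _ => n) (fun _ => k)).
by apply: tpA => // i j; rewrite !ord1.
Qed.

(* Bottom-up elimination of the first column with a nonzero entry below the
   diagonal keeps total positivity: this is Whitney's reduction. *)
Lemma tp_eliminate (R : realFieldType) (A : nat -> nat -> R) N p j0 :
    tp_on N N A -> (j0 <= p)%N -> (p.+1 < N)%N ->
    (forall n k, (n < k)%N -> A n k = 0) ->
    (forall n, (n < N)%N -> 0 < A n n) ->
    (forall n k, (k < n < N)%N -> (k < j0)%N -> A n k = 0) ->
    (forall n, (p.+1 < n < N)%N -> A n j0 = 0) ->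
    A p.+1 j0 != 0 ->
  0 < A p j0 /\
  tp_on N N (fun n k => rowop (p, - (A p.+1 j0 / A p j0)) (A^~ k) n).
Proof.
move=> tpA jp pN low dpos zlt zcol nz.
have b_gt0 : 0 < A p.+1 j0 by rewrite lt_def nz (tp_entry tpA) //; lia.
have a_gt0 : 0 < A p j0.
  move: jp; rewrite leq_eqVlt => /orP[/eqP ->|jp]; first by apply: dpos; lia.
  rewrite lt_def (tp_entry tpA) ?andbT; [|lia|lia].
  apply/eqP => a0.
  have pp_gt0 : 0 < A p p by apply: dpos; lia.
  (* If [A p j0] were zero, the minor on rows [p], [p.+1] and columns [j0], [p] would equal
     [- (A p p * A p.+1 j0) < 0]. *)
  have : 0 <= minor A (fun i : 'I_2 => if i == 0 then p else p.+1)
                      (fun i => if i == 0 then j0 else p).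
    by apply: tpA => [[[|[|i]]//= ?] [[|[|k]]//= ?]|[[|[|i]]//= ?] [[|[|k]]//= ?]|i|i];
       rewrite -?val_eqE //=; try case: ifP; lia.
  by rewrite minor2 /= a0 mul0r sub0r oppr_ge0 leNgt mulr_gt0.
split=> //; apply: tp_rowop_neg => //= m r c t hr hc rN cN rt rp.
have := whitney_ratio tpA pN _ _ zcol a_gt0 hr hc rN cN rt rp.
move=> /(_ _ _)H; rewrite mulNr subr_ge0 mulrAC ler_pdivrMr // [leRHS]mulrC.
apply: H => [|n k np kj]; first by lia.
by apply: zlt; lia.
Qed.

Lemma rowop_local (R : nzRingType) N e (u v : nat -> R) :
    (forall n, (n < N)%N -> u n = v n) ->
  forall n, (n < N)%N -> rowop e u n = rowop e v n.
Proof.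
move=> uv n nN; rewrite /rowop uv //; case: eqP => // ne; rewrite uv //; lia.
Qed.

(** Columns are cleared from left to right, each from the bottom up. In [gen], the columns before
    [j] are clear below the diagonal and [s] columns remain; at [s = 0] the section is diagonal. *)
Lemma whitney_factor (R : realFieldType) (A : nat -> nat -> R) N :
    tp_on N N A ->
    (forall n k, (n < k)%N -> A n k = 0) ->
    (forall n, (n < N)%N -> 0 < A n n) ->
  exists (es : seq (nat * R)) (d : nat -> R),
    [/\ all (fun e => 0 <= e.2) es, forall n, 0 < d n &
        forall (v : nat -> R) n, (n < N)%N ->
          \sum_(j < N) A n j * v j = rowops es (fun i => d i * v i) n].
Proof.
suff gen s j : (j + s = N)%N ->
    (forall n k, (k < n < N)%N -> (k < j)%N -> A n k = 0) ->
    tp_on N N A -> (forall n k, (n < k)%N -> A n k = 0) ->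
    (forall n, (n < N)%N -> 0 < A n n) ->
  exists (es : seq (nat * R)) (d : nat -> R),
    [/\ all (fun e => 0 <= e.2) es, forall n, 0 < d n &
        forall (v : nat -> R) n, (n < N)%N ->
          \sum_(j < N) A n j * v j = rowops es (fun i => d i * v i) n].
  exact: (gen N 0%N).
elim: s j A => [|s IHs] j A js zlt tpA low dpos.
  (* The value 1 outside the section makes [d] positive everywhere. *)
  exists [::], (fun n => if (n < N)%N then A n n else 1); split=> //.
    by move=> n; case: ifP => // /dpos.
  move=> v n nN /=; rewrite nN (bigD1 (Ordinal nN)) //= big1 ?addr0 // => i ne.
  have [ni|in_|ein] := ltngtP n i; first by rewrite low ?mul0r.
    by rewrite zlt ?mul0r //; have := ltn_ord i; lia.
  by move: ne; rewrite -val_eqE /= ein eqxx.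
(* Inner induction on the last row where column [j] may be nonzero; the initial bound [N] is
   vacuous. *)
have [M zcol] : exists M, forall n, (M < n < N)%N -> A n j = 0.
  by exists N => n ?; exfalso; lia.
elim: M A zlt tpA low dpos zcol => [|p IHp] A zlt tpA low dpos zcol.
  apply: (IHs j.+1) => // [|n k kn]; first by lia.
  rewrite ltnS leq_eqVlt => /orP[/eqP kj|kj]; last by apply: zlt; lia.
  by rewrite kj zcol //; lia.
have [pj|jp] := ltnP p j.
  apply: (IHs j.+1) => // [|n k kn]; first by lia.
  rewrite ltnS leq_eqVlt => /orP[/eqP kj|kj]; last by apply: zlt; lia.
  by rewrite kj zcol //; lia.
have [pN|Np] := ltnP p.+1 N; last first.
  by apply: IHp => // n pn; exfalso; lia.
have [b0|bn0] := eqVneq (A p.+1 j) 0.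
  apply: IHp => // n pn; have [->//|np] := eqVneq n p.+1.
  by apply: zcol; lia.
have [a_gt0 tpA'] := tp_eliminate tpA jp pN low dpos zlt zcol bn0.
set q := A p.+1 j / A p j in tpA'.
have q_ge0 : 0 <= q.
  by apply: divr_ge0 (ltW a_gt0); apply: (tp_entry tpA); lia.
have [||||es [d [es0 d0 H]]] := IHp _ _ tpA'.
- move=> n k kn kj; rewrite /rowop /= zlt // add0r; case: eqP => // np.
  by rewrite zlt ?mulr0 //; lia.
- move=> n k nk; rewrite /rowop low // add0r; case: eqP => //= np.
  by rewrite low ?mulr0 //; lia.
- move=> n nN; rewrite /rowop; case: eqP => [->|_] /=; last by rewrite addr0 dpos.
  by rewrite (low p) // mulr0 addr0 dpos.
- move=> n pn; rewrite /rowop; have [->|np] := eqVneq n p.+1.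
    by rewrite /= mulNr divfK ?subrr // gt_eqF.
  by rewrite addr0; apply: zcol; lia.
(* The elimination used [- q], so [A] is recovered by the inverse operation with [q], performed
   last. *)
exists (rcons es (p, q)), d; split=> //; first by rewrite all_rcons /= q_ge0.
move=> v n nN; rewrite /rowops foldl_rcons.
rewrite -(rowop_local _ (H v)) // /rowop /=; case: eqP => [->|_].
  rewrite mulr_sumr -big_split /=; apply: eq_bigr => i _.
  by rewrite ltn_eqF // addr0; ring.
by rewrite addr0; apply: eq_bigr => i _; rewrite addr0.
Qed.

(** * Total positivity of the array and of its reversal *)

Definition dsum1 (R : nzRingType) (A : nat -> nat -> R) (n k : nat) : R :=
  match n, k with
  | 0%N, 0%N => 1
  | n'.+1, k'.+1 => A n' k'
  | _, _ => 0
  end.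

(** If index 0 occurs only among the rows or only among the columns, the minor has a zero row or
    column. If it occurs in both, expand along row 0; if in neither, it is a minor of [A]. *)
Lemma tp_dsum1 (R : realFieldType) (A : nat -> nat -> R) N K :
  tp_on N K A -> tp_on N.+1 K.+1 (dsum1 A).
Proof.
move=> tpA [|m] r c hr hc rN cK; first by rewrite /minor det_mx00.
have sub m' (r' c' : 'I_m' -> nat) :
    {homo r' : i j / (i < j)%N} -> {homo c' : i j / (i < j)%N} ->
    (forall i, (0 < r' i < N.+1)%N) -> (forall j, (0 < c' j < K.+1)%N) ->
  0 <= minor (dsum1 A) r' c'.
  move=> hr' hc' r'N c'K.
  rewrite (@eq_minor _ _ A _ _ (fun i => (r' i).-1) _ (fun i => (c' i).-1)).
    apply: tpA => [i j ij|i j ij|i|i].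
    - by have := hr' _ _ ij; have := r'N i; have := r'N j; lia.
    - by have := hc' _ _ ij; have := c'K i; have := c'K j; lia.
    - by have := r'N i; lia.
    - by have := c'K i; lia.
  move=> i j; have := r'N i; have := c'K j.
  by case: (r' i) => //; case: (c' j).
have pos (f : 'I_m.+1 -> nat) (hf : {homo f : i j / (i < j)%N}) (i : 'I_m.+1) :
    (0 < f ord0)%N || (i != ord0) -> (0 < f i)%N.
  case: (eqVneq i ord0) => [->|i0 _]; first by rewrite orbF.
  by apply: leq_ltn_trans (hf ord0 i _) => //; rewrite lt0n.
case: (posnP (r ord0)) => [r0|r0]; case: (posnP (c ord0)) => [c0|c0].
- rewrite (minor_row _ _ _ ord0) big_ord_recl big1 ?addr0; last first.
    move=> j _; rewrite r0.
    have := pos c hc (lift ord0 j); rewrite eq_sym neq_lift orbT => /(_ isT).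
    by case: (c _) => // k _; rewrite mul0r.
  rewrite r0 c0 /= expr0 !mul1r; apply: sub => [||i|i] /=.
  - exact: lift_homo.
  - exact: lift_homo.
  - by rewrite rN pos // eq_sym neq_lift orbT.
  - by rewrite cK pos // eq_sym neq_lift orbT.
- rewrite (@minor_row0 _ _ _ _ _ ord0) // => j; rewrite r0.
  by have := pos c hc j; rewrite c0 => /(_ isT); case: (c j).
- rewrite (@minor_col0 _ _ _ _ _ ord0) // => i; rewrite c0.
  by have := pos r hr i; rewrite r0 => /(_ isT); case: (r i).
- by apply: sub => // i; rewrite ?rN ?cK pos ?r0 ?c0.
Qed.

(** Weak monotonicity suffices because a repeated row makes the minor vanish. This admits the
    truncated shift from [s] to [s - q]. *)
Lemma tp_select (R : realFieldType) (A : nat -> nat -> R) N N' K (g : nat -> nat) :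
    {homo g : i j / (i <= j)%N} -> (forall n, (n < N')%N -> (g n < N)%N) ->
  tp_on N K A -> tp_on N' K (fun n k => A (g n) k).
Proof.
move=> hg gN tpA m r c hr hc rN cK.
rewrite (@eq_minor _ _ A _ _ (g \o r) _ c) //.
have [inj|/injectivePn[i [j ij eq_g]]] := boolP (injectiveb (g \o r)).
  apply: tpA => // [i j ij|i]; last by apply: gN.
  have /hg := ltnW (hr _ _ ij); rewrite leq_eqVlt => /orP[/eqP e|//].
  by move/injectiveP: inj => /(_ _ _ e) ije; rewrite ije ltnn in ij.
by rewrite (minor_eq_rows _ _ ij).
Qed.

Lemma tp_on0 (R : realFieldType) (A : nat -> nat -> R) N : tp_on N 0 A.
Proof.
move=> [|m] r c _ _ _ cK; first by rewrite /minor det_mx00.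
by have := cK ord0.
Qed.

Lemma tp_mono (R : realFieldType) (A : nat -> nat -> R) N N' K :
  (N' <= N)%N -> tp_on N K A -> tp_on N' K A.
Proof. by move=> le tpA m r c hr hc rN cK; apply: tpA => // i; have := rN i; lia. Qed.

Lemma tp_onP (R : realFieldType) (A : nat -> nat -> R) :
  totally_positive A <-> (forall N K, tp_on N K A).
Proof.
split=> [tpA N K m r c hr hc _ _|tpA m r c hr hc]; first exact: tpA.
apply: (tpA (\max_i r i).+1 (\max_i c i).+1) => // i; rewrite ltnS.
  exact: (leq_bigmax i).
exact: (leq_bigmax i).
Qed.

(* Row s of [b] holds the coefficients of a polynomial b_s(x), and the last
   condition reads b_(s+1)(x) = d_s b_s(x) + w_s x b_(s-q)(x). *)
Definition lag_recurrence (R : numDomainType) (S q : nat) (d w : nat -> R)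
    (b : nat -> nat -> R) : Prop :=
  [/\ forall s, 0 < d s, forall s, 0 <= w s, forall k, b 0%N k = (k == 0%N)%:R &
      forall s k, (s < S)%N ->
        b s.+1 k = d s * b s k + w s * (if k is k'.+1 then b (s - q)%N k' else 0)].

(** The matrix [C] has rows 1 and [w_s x b_(s-q)]. Because of the factor x, its first [K.+1] columns
    involve only [K] columns of [b]; adding [d_j] times row [j] to row [j.+1], from the top down,
    turns [C] into [b]. *)
Lemma tp_lag (R : realFieldType) S q (d w : nat -> R) b K :
  lag_recurrence S q d w b -> tp_on S.+1 K b.
Proof.
case=> d_gt0 w_ge0 b0 bS; elim: K => [|K IH]; first exact: tp_on0.
pose C := dsum1 (fun s k => w s * b (s - q)%N k).
have tpC : tp_on S.+1 K.+1 C.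
  apply: tp_mono (leqnSn _) _; apply: tp_dsum1.
  have tpb : tp_on S.+1 K (fun s k => b (s - q)%N k).
    by apply: tp_select IH => [i j|n]; lia.
  have := tp_scale w_ge0 (fun=> ler01) tpb.
  by apply: eq_tp_on => n k _ _; rewrite mulr1.
(* Rows up to [j] are already those of [b], the later ones still those of [C]. *)
have step j : (j <= S)%N ->
    tp_on S.+1 K.+1 (fun s k => if (s <= j)%N then b s k else C s k).
  elim: j => [|j IHj] jS.
    by apply: eq_tp_on tpC => -[|n] [|k] _ _; rewrite ?b0.
  have := @tp_rowop _ _ _ _ (j, d j) (ltW (d_gt0 j)) (IHj (ltnW jS)).
  apply: eq_tp_on => n k _ _; rewrite /rowop /=.
  have [->|nj] := eqVneq n j.+1.
    by rewrite ltnn !leqnn /= bS //; case: k => [|k]; rewrite /C /= ?mulr0 addrC.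
  by rewrite addr0 [in RHS]leq_eqVlt (negPf nj) ltnS.
apply: eq_tp_on (step S (leqnn S)) => n k nS _.
by rewrite -ltnS nS.
Qed.

Lemma eq_rowops (R : nzRingType) (es : seq (nat * R)) u v :
  u =1 v -> rowops es u =1 rowops es v.
Proof.
elim: es u v => [|e es IH] u v uv //=; apply: IH => n.
by rewrite /rowop !uv.
Qed.

(** The first [K.+1] columns of [dsum1 M] involve only [K] columns of [M], and the factored [T]
    carries their total positivity over to [M]. *)
Lemma tp_recursion (R : realFieldType) (T M : nat -> nat -> R) :
    totally_positive T -> (forall n k, (n < k)%N -> T n k = 0) ->
    (forall n, 0 < T n n) ->
    (forall N n k, (n < N)%N -> M n k = \sum_(j < N) T n j * dsum1 M j k) ->
  totally_positive M.
Proof.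
move=> /tp_onP tpT low dpos MT; apply/tp_onP => N K.
have [es [d [es_ge0 d_gt0 fac]]] := whitney_factor (tpT N N) low (fun n _ => dpos n).
elim: K => [|K IH]; first exact: tp_on0.
have tpE : tp_on N K.+1 (dsum1 M) by apply: tp_mono (leqnSn _) (tp_dsum1 IH).
have := tp_rowops es_ge0 (tp_scale (fun n => ltW (d_gt0 n)) (fun=> ler01) tpE).
apply: eq_tp_on => n k nN _; rewrite (MT N) // (fac (fun j => dsum1 M j k)) //.
by apply: eq_rowops => i; rewrite mulr1.
Qed.

Lemma rowops_take (R : nzRingType) (es : seq (nat * R)) v i : (i < size es)%N ->
  rowops (take i.+1 es) v = rowop (nth (0%N, 0) es i) (rowops (take i es) v).
Proof. by move=> i_lt; rewrite /rowops (take_nth (0%N, 0)) // foldl_rcons. Qed.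

(** Index [n * q + 0] holds the reversed row [n] of [dsum1 M], and [n * q + i.+1] the same row after
    diagonal scaling and [i] operations. Every row takes [q] steps, so the same stage of the
    preceding row is always [q] places back; reversal turns the change of row length into a factor
    x. *)
Lemma lag_of_recursion (R : realFieldType) (T M : nat -> nat -> R) N :
    totally_positive T -> (forall n k, (n < k)%N -> T n k = 0) ->
    (forall n, 0 < T n n) ->
    (forall N n k, (n < N)%N -> M n k = \sum_(j < N) T n j * dsum1 M j k) ->
  exists q (d w : nat -> R) b,
    [/\ lag_recurrence (N * q) q d w b,
        forall n k, (n < N)%N -> b (n.+1 * q)%N k = reversal M n k &
        forall s k, (s <= N * q)%N -> (N < k)%N -> b s k = 0].
Proof.
move=> /tp_onP tpT low dpos MT.
have [es [d [es_ge0 d_gt0 fac]]] := whitney_factor (tpT N N) low (fun n _ => dpos n).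
have lowM n k : (n < k)%N -> M n k = 0.
  elim: k n => // k IH n nk; rewrite (MT n.+1) // big1 // => -[[|j] jn] _ /=.
    by rewrite mulr0.
  by rewrite IH ?mulr0 //; lia.
pose m := size es; pose q := m.+1.
pose u i n k := rowops (take i es) (fun n => d n * dsum1 M n k) n.
have low_u i n k : (i <= m)%N -> (n < k)%N -> u i n k = 0.
  elim: i n k => [|i IH] n k im nk.
    rewrite /u take0 /=; case: n k nk => [|n] [|k] //= nk; rewrite ?mulr0 //.
    by rewrite lowM ?mulr0.
  rewrite /u rowops_take // /rowop -/(u i n k) IH ?add0r //; last by lia.
  by case: eqP => // ne; rewrite -/(u i _ k) IH ?mulr0 //; lia.
pose ur i n k := if (k <= n)%N then u i n (n - k)%N else 0.
pose br n k := if (k <= n)%N then dsum1 M n (n - k)%N else 0.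
pose bb n i k := if i is i'.+1 then ur i' n k else br n k.
pose b s k := bb (s %/ q)%N (s %% q)%N k.
have bE n i k : (i <= m)%N -> b (n * q + i)%N k = bb n i k.
  by move=> im; rewrite /b divnMDl // modnMDl divn_small ?modn_small ?addn0.
have M_u n k : (n < N)%N -> M n k = u m n k.
  by move=> nN; rewrite (MT N) // (fac (fun j => dsum1 M j k)) // /u take_size.
have br_wrap n k : (n < N)%N -> br n.+1 k = ur m n k.
  move=> nN; rewrite /br /ur; have [kn|nk] := leqP k n.
    by rewrite (leqW kn) subSn //= M_u.
  by case: leqP => // kn; rewrite (_ : (n.+1 - k = 0)%N) //; lia.
have b_next n i k : (n < N)%N -> (i <= m)%N -> b (n * q + i).+1 k = ur i n k.
  move=> nN; rewrite leq_eqVlt => /orP[/eqP ->|im].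
    by rewrite -addnS -[X in (_ + X)%N]addn0 addnA -mulSnr bE //= br_wrap.
  by rewrite -addnS bE.
(* The first step of each block scales by [d]. A later step has nonzero weight only if its operation
   targets the current row, which is then not row 0, so [s - q] is not truncated. *)
pose dd s := if (s %% q == 0)%N then d (s %/ q)%N else 1.
pose ww s := if (s %% q)%N is i.+1 then
  let e := nth (0%N, 0) es i in if (s %/ q == e.1.+1)%N then e.2 else 0 else 0.
exists q, dd, ww, b; split.
- split=> [s|s|k|s k sN].
  + by rewrite /dd; case: ifP.
  + rewrite /ww; case: (s %% q)%N (ltn_pmod s (isT : 0 < q)%N) => // i im /=.
    by case: ifP => // _; apply: (all_nthP _ es_ge0).
  + by rewrite -[0%N]/(0 * q + 0)%N bE // /bb /br; case: k.
  have : (s %% q <= m)%N by rewrite -ltnS ltn_pmod.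
  have : (s %/ q < N)%N by rewrite ltn_divLR.
  rewrite /dd /ww; move: (divn_eq s q).
  set n := (s %/ q)%N; set i := (s %% q)%N => -> nN im.
  rewrite b_next // bE //; case: i im => [|i] im /=.
    rewrite mul0r addr0 /ur /br /u take0 /=.
    by case: ifP; rewrite ?mulr0.
  rewrite mul1r {1}/ur /u rowops_take // /rowop -/(ur i n k).
  set e := nth _ es i; case: eqP => [ne|_]; last first.
    by rewrite mul0r addr0 /ur; case: ifP; rewrite ?addr0.
  have -> : (n * q + i.+1 - q = e.1 * q + i.+1)%N by rewrite ne mulSn -addnA addKn.
  (* At [k = 0] the entry added by the operation lies just above the diagonal, hence is zero. *)
  case: k => [|k]; rewrite ?mulr0 ?addr0 /ur /=.
    by rewrite -/(u i e.1 (n - 0)%N) subn0 low_u ?mulr0 ?addr0 ?ne //; lia.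
  rewrite bE //= /ur ne ltnS subSS; case: ifP => kn; rewrite ?mulr0 ?addr0 //.
- move=> n k nN; rewrite -[(_ * q)%N]addn0 bE //= br_wrap //.
  by rewrite /ur /reversal; case: ifP => // _; rewrite M_u.
move=> s k sN Nk; have : (s %/ q <= N)%N by rewrite -(mulnK N (isT : 0 < q)%N) leq_div2r.
move=> nN; have nk : (k <= s %/ q)%N = false by apply/negbTE; rewrite -ltnNge; lia.
by rewrite /b /bb /br /ur; case: (s %% q)%N => [|i]; rewrite nk.
Qed.

(** * Real-rootedness *)

(** This is the imaginary part of the conjugate of [u] times [v]; its sign tells on which side of
    [u] the vector [v] lies. *)
Definition wedge (R : rcfType) (u v : R[i]) : R :=
  complex.Re u * complex.Im v - complex.Im u * complex.Re v.

Lemma wedge_lag (R : rcfType) (a b : R) (z u x y : R[i]) :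
  wedge u (a%:C%C * x + b%:C%C * z * y) = a * wedge u x + b * wedge u (z * y).
Proof. by case: z u x y => [z1 z2] [u1 u2] [x1 x2] [y1 y2]; rewrite /wedge /=; ring. Qed.

(** Multiplying both arguments by [z] scales [wedge] by the squared modulus of [z]. *)
Lemma wedge_lagZ (R : rcfType) (a b : R) (z u x y : R[i]) :
  wedge (a%:C%C * x + b%:C%C * z * y) (z * u) =
  a * wedge x (z * u) +
  b * ((complex.Re z ^+ 2 + complex.Im z ^+ 2) * wedge y u).
Proof. by case: z u x y => [z1 z2] [u1 u2] [x1 x2] [y1 y2]; rewrite /wedge /=; ring. Qed.

Lemma wedgexx (R : rcfType) (u : R[i]) : wedge u u = 0.
Proof. by rewrite /wedge mulrC subrr. Qed.

(* For Im z > 0 the invariant says that the arguments of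
   beta_(s-q), ..., beta_s increase and stay below arg z + arg beta_(s-q). *)
Lemma lag_nonvanishing (R : rcfType) S q (d w : nat -> R) (z : R[i])
    (beta : nat -> R[i]) :
    (forall s, 0 < d s) -> (forall s, 0 <= w s) -> complex.Im z != 0 ->
    beta 0%N != 0 ->
    (forall s, (s < S)%N ->
      beta s.+1 = (d s)%:C%C * beta s + (w s)%:C%C * z * beta (s - q)%N) ->
  forall s, (s <= S)%N -> beta s != 0.
Proof.
move=> d_gt0 w_ge0 z_im b0 rec.
(* The factor [complex.Im z] treats both half-planes at once; the product is the square of
   [complex.Im z] times the squared modulus of [x]. *)
have diag x : 0 <= complex.Im z * wedge x (z * x).
  case: z x {z_im rec} => [z1 z2] [x1 x2]; rewrite /wedge /=.
  rewrite (_ : _ * _ = z2 ^+ 2 * (x1 ^+ 2 + x2 ^+ 2)); last by ring.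
  by rewrite mulr_ge0 ?addr_ge0 ?sqr_ge0.
suff inv s : (s <= S)%N -> (forall t, (t <= s)%N -> beta t != 0) /\
    forall i j, (i <= j <= s)%N -> (j <= i + q)%N ->
      0 <= complex.Im z * wedge (beta i) (beta j) /\
      0 <= complex.Im z * wedge (beta j) (z * beta i).
  by move=> s /inv[/(_ s (leqnn s))].
elim: s => [|s IH] sS.
  split=> [t|i j]; first by rewrite leqn0 => /eqP ->.
  move=> ij _; have [-> ->] : i = 0%N /\ j = 0%N by lia.
  by split; [rewrite wedgexx mulr0|apply: diag].
have [nz inv] := IH (ltnW sS).
(* By bilinearity, each quantity for [beta s.+1] is a nonnegative combination of one from the pair
   [i], [s] and one from the pair [s - q], [i]. *)
have step i : (s - q <= i <= s)%N ->
    0 <= complex.Im z * wedge (beta i) (beta s.+1) /\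
    0 <= complex.Im z * wedge (beta s.+1) (z * beta i).
  move=> his; have [||i1 i2] := inv i s; [lia|lia|].
  have [||j1 j2] := inv (s - q)%N i; [lia|lia|].
  rewrite rec // wedge_lag wedge_lagZ; move: i1 i2 j1 j2.
  move: (wedge _ _) (wedge _ _) (wedge _ _) (wedge _ _) => A1 A2 A3 A4 i1 i2 j1 j2.
  rewrite !mulrDr.
  rewrite !(mulrCA _ (d s)) !(mulrCA _ (w s)) (mulrCA _ (_ + _)).
  split; apply: addr_ge0; apply: mulr_ge0; rewrite ?(ltW (d_gt0 s)) //.
  by apply: mulr_ge0; rewrite // addr_ge0 ?sqr_ge0.
split=> [t|i j].
  rewrite leq_eqVlt => /orP[/eqP ->|]; last by rewrite ltnS; apply: nz.
  (* If [beta s.+1] vanished, taking the wedge of [beta (s - q)] with the recurrence would equate a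
     nonnegative number with [- w s] times a positive one. So [w s = 0], and then [beta s = 0], a
     contradiction. *)
  apply/eqP => bs0.
  have [||h _] := inv (s - q)%N s; [lia|lia|].
  have x0 := nz (s - q)%N (leq_subr _ _); have y0 := nz s (leqnn s).
  move: (rec s sS) h; rewrite bs0; set x := beta (s - q)%N in x0 *.
  set y := beta s in y0 *; set a := d s; set b := w s.
  have a_gt0 : 0 < a := d_gt0 s; have b_ge0 : 0 <= b := w_ge0 s.
  clearbody x y a b; clear - x0 y0 a_gt0 b_ge0 z_im.
  case: z x y x0 y0 z_im => [z1 z2] [x1 x2] [y1 y2] /=.
  rewrite !eq_complex /= !negb_and /wedge /= => x0 y0 z0 [e1 e2] h.
  have xpos : 0 < x1 ^+ 2 + x2 ^+ 2.
    rewrite lt_def addr_ge0 ?sqr_ge0 // andbT paddr_eq0 ?sqr_ge0 //.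
    by rewrite !sqrf_eq0 negb_and.
  have zpos : 0 < z2 ^+ 2 by rewrite lt_def sqrf_eq0 z0 sqr_ge0.
  have : a * (z2 * (x1 * y2 - x2 * y1)) = - (b * (z2 ^+ 2 * (x1 ^+ 2 + x2 ^+ 2))).
    have e1' : a * y1 = - (b * (z1 * x1 - z2 * x2)) by lra.
    have e2' : a * y2 = - (b * (z1 * x2 + z2 * x1)) by lra.
    transitivity (z2 * (x1 * (a * y2) - x2 * (a * y1))); first by ring.
    by rewrite e1' e2'; ring.
  move=> key; have : b * (z2 ^+ 2 * (x1 ^+ 2 + x2 ^+ 2)) <= 0.
    by rewrite -oppr_ge0 -key mulr_ge0 // ltW.
  rewrite pmulr_lle0 ?(mulr_gt0 zpos xpos) // => b_le0.
  have b0 : b = 0 by apply/eqP; rewrite eq_le b_le0 b_ge0.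
  move: e1 e2 y0; rewrite b0 => e1 e2.
  have /eqP : a * y1 = 0 by lra.
  have /eqP : a * y2 = 0 by lra.
  by rewrite !mulf_eq0 (gt_eqF a_gt0) /= => -> ->.
case/andP => ij; rewrite leq_eqVlt => /orP[/eqP js|js] jq; last first.
  by apply: inv => //; lia.
move: ij; rewrite leq_eqVlt => /orP[/eqP ->|ij]; last first.
  by rewrite js; apply: step; lia.
split; last exact: diag.
by rewrite wedgexx mulr0.
Qed.

(** The recurrence yields the reversed row polynomial, so it is evaluated at [y], the inverse of a
    non-real [z], which is again non-real. *)
Lemma real_rooted_lag (R : realType) (M : nat -> nat -> R) n S q d w b :
    lag_recurrence S q d w b -> (n.+1 * q <= S)%N ->
    (forall k, b (n.+1 * q)%N k = reversal M n k) ->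
    (forall s k, (s <= S)%N -> (n.+1 < k)%N -> b s k = 0) ->
  real_rooted (row_poly M n).
Proof.
move=> [d_gt0 w_ge0 b0 bS] qS bM b_supp; right=> z.
rewrite /root (@horner_coef_wide _ n.+1); last first.
  by apply: leq_trans (size_poly _ _) _; apply: size_poly.
move=> root_z; apply/eqP; apply: contraLR root_z => z_im.
have z0 : z != 0 by apply: contraNneq z_im => ->.
pose y := z^-1.
have y_im : complex.Im y != 0.
  apply/eqP => y_im; have : z * y = 1 by rewrite divff.
  have : y != 0 by rewrite invr_neq0.
  clearbody y; move: z_im y_im; clear; case: z y => [z1 z2] [y1 y2] /= z2_0 -> y_0 [].
  rewrite !mulr0 add0r => _ /eqP; rewrite mulf_eq0 (negPf z2_0) /= => /eqP y1_0.
  by move: y_0; rewrite y1_0 eqxx.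
(* The coefficients vanish beyond [n.+1]; one extra term is kept so that multiplication by [y]
   pushes out only a zero. *)
pose beta s := \sum_(k < n.+3) (b s k)%:C%C * y ^+ k.
have : beta (n.+1 * q)%N != 0.
  apply: (@lag_nonvanishing _ S q d w y) => // [|s sS].
    rewrite /beta big_ord_recl big1 => [|k _]; rewrite b0 /=.
      by rewrite addr0 mulr1 oner_neq0.
    by rewrite mul0r.
  rewrite /beta mulr_sumr -mulrA mulr_sumr mulr_sumr.
  have -> : \sum_(k < n.+3) (w s)%:C%C * (y * ((b (s - q)%N k)%:C%C * y ^+ k)) =
    \sum_(k < n.+3) (w s)%:C%C *
      ((if (k : nat) is k'.+1 then b (s - q)%N k' else 0)%:C%C * y ^+ k) :> R[i].
    rewrite big_ord_recr [RHS]big_ord_recl /= b_supp //; last by lia.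
    rewrite !mul0r !mulr0 addr0 add0r; apply: eq_bigr => k _.
    by rewrite /= exprS; congr (_ * _); rewrite mulrCA.
  rewrite -big_split; apply: eq_bigr => k _ /=.
  by rewrite bS // rmorphD !rmorphM mulrDl !mulrA.
apply: contraNN => /eqP sum0; apply/eqP.
(* Reversing the summation identifies [beta (n.+1 * q)] with [y ^+ n] times the row polynomial at
   [z]. *)
rewrite -[RHS](mulr0 (y ^+ n)) -sum0 mulr_sumr (reindex_inj rev_ord_inj) /=.
rewrite /beta !(big_ord_recr n.+2) !(big_ord_recr n.+1) /= !bM /reversal.
rewrite ltnn ltnNge leqW //= !mul0r !addr0.
apply: eq_bigr => k _; have kn : (k <= n)%N by rewrite -ltnS.
rewrite bM /reversal kn subSS coef_map coef_poly ltnS leq_subr /= mulrCA; congr (_ * _).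
by rewrite -{2}(subnKC kn) exprD -mulrA -exprMn mulVf // expr1n mulr1.
Qed.

(** * The Riordan array of f' and f *)

(** Truncation to polynomials gives access to the formal derivative and its power rule. *)
Lemma fps_exp_poly (R : nzRingType) (F : nat -> R) N k n : (n < N)%N ->
  fps_exp F k n = ((\poly_(i < N) F i) ^+ k)`_n.
Proof.
elim: k n => [|k IH] n nN; first by rewrite expr0 coef1.
rewrite exprS coefM; apply: eq_bigr => i _.
have iN : (i < N)%N by have := ltn_ord i; lia.
by rewrite coef_poly iN -IH //; lia.
Qed.

Lemma fps_exp_deriv (R : comNzRingType) (F : nat -> R) k n :
  fps_exp F k.+1 n.+1 *+ n.+1 = fps_mul (fps_deriv F) (fps_exp F k) n *+ k.+1.
Proof.
rewrite (@fps_exp_poly _ _ n.+2) // -coef_deriv deriv_exp coefMn coefM.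
congr (_ *+ _); apply: eq_bigr => i _; have := ltn_ord i => ni.
rewrite coef_deriv coef_poly ltnS ni (@fps_exp_poly _ _ n.+2) //; lia.
Qed.

(** Expand the product of F' and F^k, then rewrite each coefficient of F^k by [fps_exp_deriv]; the
    factorials turn it into an entry of [dsum1]. Terms with [j > n] vanish, so any [N > n]
    serves. *)
Lemma riordan_recursion (R : numFieldType) (F : nat -> R) N n k :
    F 0%N = 0 -> (n < N)%N ->
  exp_riordan (fps_deriv F) F n k =
  \sum_(j < N) n`!%:R * toeplitz (fps_deriv F) n j * j`!%:R^-1 *
    dsum1 (exp_riordan (fps_deriv F) F) j k.
Proof.
move=> F0 nN; rewrite [RHS](bigID (fun j : 'I_N => (j < n.+1)%N)) /=.
rewrite [X in _ = _ + X]big1 ?addr0; last first.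
  by move=> j; rewrite /toeplitz ltnS => /negPf ->; rewrite mulr0 !mul0r.
rewrite -(big_ord_widen N (fun j => n`!%:R * toeplitz (fps_deriv F) n j * j`!%:R^-1 *
    dsum1 (exp_riordan (fps_deriv F) F) j k)) //.
rewrite {1}/exp_riordan /fps_mul mulr_sumr (reindex_inj rev_ord_inj) /=.
apply: eq_bigr => j _; have jn : (j <= n)%N by rewrite -ltnS.
rewrite /toeplitz jn subSS subKn // -!mulrA; congr (_ * _).
rewrite [LHS]mulrCA; congr (_ * _).
have fact_neq0 m : m`!%:R != 0 :> R by rewrite pnatr_eq0 -lt0n fact_gt0.
case: (j : nat) k => [|i] [|k] /=; rewrite ?mulr0 //.
- by rewrite /fps_exp /= /fps_mul big_ord1 F0 mul0r mulr0.
rewrite /exp_riordan -/(fps_mul _ _ _) mulrA; apply/(mulfI (fact_neq0 k.+1)).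
rewrite mulVKf //; apply/(mulIf (_ : i.+1%:R != 0)); first by rewrite pnatr_eq0.
rewrite mulr_natr fps_exp_deriv !factS !natrM -mulr_natl; field.
by rewrite !fact_neq0 nat1r pnatr_eq0.
Qed.

Theorem theorem4p2 (R : realType) (f : nat -> R)
  (f0 : f 0%N = 0) (f1 : f 1%N <> 0) :
  let F := egf f in
  let M := exp_riordan (fps_deriv F) F in
  pf_seq (fps_deriv F) ->
  [/\ totally_positive M,
      totally_positive (reversal M) &
      forall n : nat, real_rooted (row_poly M n)].
Proof.
move=> F M [c_ge0 /tp_onP tp_c].
have F0 : F 0%N = 0 by rewrite /F /egf f0 mul0r.
pose T n k := n`!%:R * toeplitz (fps_deriv F) n k * k`!%:R^-1.
have tpT : totally_positive T.
  by apply/tp_onP => N K; apply: tp_scale => // n; rewrite ?invr_ge0 ler0n.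
have lowT n k : (n < k)%N -> T n k = 0.
  by move=> nk; rewrite /T /toeplitz leqNgt nk mulr0 mul0r.
(* The diagonal entry is the constant coefficient [f 1], nonzero by hypothesis and nonnegative by
   the PF property. *)
have diagT n : 0 < T n n.
  rewrite /T /toeplitz leqnn subnn mulrAC divff ?mul1r; last first.
    by rewrite pnatr_eq0 -lt0n fact_gt0.
  rewrite lt_def c_ge0 andbT /fps_deriv /F /egf mulr1n (_ : 1`! = 1%N) // divr1.
  exact/eqP.
have rec N n k : (n < N)%N -> M n k = \sum_(j < N) T n j * dsum1 M j k.
  exact: riordan_recursion.
have lag N := lag_of_recursion N tpT lowT diagT rec.
split; first exact: tp_recursion rec.
  apply/tp_onP => N K; have [q [d [w [b [lagb bM _]]]]] := lag N.
  have tpb : tp_on N K (fun n k => b (n.+1 * q)%N k).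
    apply: (@tp_select _ b _ _ _ (fun n => n.+1 * q)%N) (tp_lag lagb) => [i j ij|n nN].
      by rewrite leq_mul2r ltnS ij orbT.
    by rewrite ltnS leq_mul2r nN orbT.
  by apply: eq_tp_on tpb => n k nN _; apply: bM.
move=> n; have [q [d [w [b [lagb bM b_supp]]]]] := lag n.+1.
exact: real_rooted_lag lagb (leqnn _) (fun k => bM n k (ltnSn n)) b_supp.
Qed.
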